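(* Let $N$ and $H$ be countable groups, let $\alpha:H\to{\rm Aut}(N)$ be an action of $H$ on $N$, and let $G=N\rtimes_\alpha H$ be the semidirect product under $\alpha$. Suppose that $N$ and $H$ satisfy (SAFC), with $\{N_l\}\subset N$ and $\{H_l\}\subset H$ the corresponding symmetric Følner sequences. Suppose there exist a positive integer $M\ge1$ and a function $\xi:\mathbb N\times\mathbb N\to\mathbb N$ such that the following hold: (1) for all $(i,j)\in\mathbb N\times\mathbb N$, $\alpha_{H_i}(N_j)\subset N_{\xi(i,j)}$ and $\xi(i,i)\le i\cdot M$; (2) for every $(a,b)\in G$ and $\varepsilon>0$ there is an integer $K\ge1$ such that for all $l\ge K$, $|a\,\alpha_b(N_l)\cap N_l|>(1-\varepsilon)|N_l|$; (3) for every $l_1,l_2\ge1$, every $x\in N_{l_1+l_2}$ and every $b\in H_{l_1}$, $N_{l_1}x\cap\alpha_b(N_{l_2})\ne\varnothing$. Then $G$ satisfies (AFC).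
   Context: Groups are countable and discrete; $e$ is the identity. A Følner sequence in $G$ is an increasing sequence $\{F_n\}_{n\ge1}$ of finite subsets with $e\in F_n$ for all $n$, $\bigcup_nF_n=G$, and $\lim_n|gF_n\triangle F_n|/|F_n|=0$ for all $g\in G$. It is symmetric if $F_n=F_n^{-1}$ for all $n$. A finite subset $A\subset G$ is a (weakly) approximate group with respect to a natural number $L>0$ if $e\in A$ and there are $g_1,\dots,g_L\in G$ with $A^{-1}A\subset\bigcup_{i=1}^Lg_iA$; it is a strongly approximate group if moreover such $g_i$ can be chosen in $A$. $L_A$ denotes the smallest such constant. $(G,\{F_n\})$ satisfies (WAFC) with respect to a natural number $L_G$ if $\{F_n\}$ is a Følner sequence, every $F_n$ is an approximate group, and $L_{F_n}\le L_G$ for all $n$. It satisfies (AFC) if it satisfies (WAFC) and in addition $F_{n+k}\subset F_n\cdot F_k$ for all $n,k\ge1$. It satisfies (SAFC) if it satisfies (AFC) and every $F_n$ is a strongly approximate group. A group ''satisfies'' one of these conditions if it does so with some Følner sequence. In $N\rtimes_\alpha H$ the product is $(a,b)(a',b')=(a\,\alpha_b(a'),bb')$, and $\alpha_{H_i}(N_j)=\bigcup_{h\in H_i}\alpha_h(N_j)$. *)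

(* Defs.v *)
From HB Require Import structures.
From mathcomp Require Import all_boot all_order all_algebra finmap.
From mathcomp Require Import all_classical all_reals topology normedtype.

Set Implicit Arguments.
Unset Strict Implicit.
Unset Printing Implicit Defensive.

Import Order.TTheory GRing.Theory Num.Theory.
Import numFieldNormedType.Exports.

Local Open Scope fset_scope.
Local Open Scope group_scope.

Section FiniteSubsets.
Variable G : groupType.
Implicit Types (A B : {fset G}) (g : G).

Definition fmulg A B : {fset G} := [fset x * y | x in A, y in B].
Definition finvg A : {fset G} := [fset x^-1 | x in A].
Definition flcoset g A : {fset G} := [fset g * x | x in A].
Definition frcoset A g : {fset G} := [fset x * g | x in A].
Definition fsymdiff A B : {fset G} := (A `\` B) `|` (B `\` A).

End FiniteSubsets.

Section Approximate.
Variable G : groupType.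
Implicit Types (A : {fset G}) (L : nat).

Definition translates_cover L A (g : 'I_L -> G) : Prop :=
  forall x, x \in fmulg (finvg A) A -> exists i, x \in flcoset (g i) A.

Definition approx_group_wrt L A : Prop :=
  [/\ (0 < L)%N, 1 \in A & exists g : 'I_L -> G, translates_cover A g].

Definition strong_approx_group_wrt L A : Prop :=
  [/\ (0 < L)%N, 1 \in A &
      exists g : 'I_L -> G, (forall i, g i \in A) /\ translates_cover A g].

Definition approx_group A : Prop := exists L, approx_group_wrt L A.

Definition strong_approx_group A : Prop :=
  exists L, strong_approx_group_wrt L A.

(* The constant L_A; the default 0 is taken only when A is not an approximate
   group. *)
Definition approx_const A : nat :=
  xget 0%N [set L | approx_group_wrt L A /\
                    forall L', approx_group_wrt L' A -> (L <= L')%N]%classic.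

End Approximate.

(* Sequences {F_n}_{n >= 1} are functions on nat whose value at 0 is never
   constrained or used. *)
Section Sequences.
Variables (R : realType) (G : groupType).
Implicit Types F : nat -> {fset G}.

Definition Folner F : Prop :=
  [/\ forall n, (1 <= n)%N -> F n `<=` F n.+1,
      forall n, (1 <= n)%N -> 1 \in F n,
      forall g, exists2 n, (1 <= n)%N & g \in F n &
      forall g,
        (((#|` fsymdiff (flcoset g (F n)) (F n)|)%:R / (#|` F n|)%:R : R)%R
           @[n --> \oo] --> (0 : R)%R)%classic].

Definition symmetric_seq F : Prop :=
  forall n, (1 <= n)%N -> F n = finvg (F n).

Definition WAFC_wrt (LG : nat) F : Prop :=
  [/\ Folner F,
      forall n, (1 <= n)%N -> approx_group (F n) &
      forall n, (1 <= n)%N -> (approx_const (F n) <= LG)%N].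

Definition WAFC F : Prop := exists LG, WAFC_wrt LG F.

Definition AFC F : Prop :=
  WAFC F /\
  forall n k, (1 <= n)%N -> (1 <= k)%N -> F (n + k)%N `<=` fmulg (F n) (F k).

(* The constants for which the F_n are strongly approximate groups need not be
   bounded; only the L_{F_n} are. *)
Definition SAFC F : Prop :=
  AFC F /\ forall n, (1 <= n)%N -> strong_approx_group (F n).

Definition satisfies_AFC : Prop := exists F, AFC F.

End Sequences.

(* A homomorphism from H to Aut(N). *)
Record aut_action (H N : groupType) := AutAction {
  act_fun :> H -> {multiplicative N -> N};
  act_bij : forall b, bijective (act_fun b);
  actM : forall b b' a, act_fun (b * b') a = act_fun b (act_fun b' a)
}.

(* alpha_B(A), the union of the alpha_b(A) for b in B. *)
Definition act_img (H N : groupType) (alpha : aut_action H N)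
    (B : {fset H}) (A : {fset N}) : {fset N} :=
  [fset alpha b a | b in B, a in A].

(* A record rather than N * H, so as not to inherit any structure carried by
   the product type; alpha is a phantom parameter selecting the group law. *)
Record semidirect (H N : groupType) (alpha : aut_action H N) :=
  Semidirect { sd_fst : N; sd_snd : H }.

Section SemidirectProduct.
Variables (H N : groupType) (alpha : aut_action H N).
Local Notation G := (semidirect alpha).
Local Notation mk := (Semidirect alpha).

Definition sd_pair (x : G) : N * H := (sd_fst x, sd_snd x).
Definition sd_of_pair (p : N * H) : G := mk p.1 p.2.

Lemma sd_pairK : cancel sd_pair sd_of_pair.
Proof. by case. Qed.

HB.instance Definition _ := Choice.copy G (can_type sd_pairK).

Definition sd_one : G := mk 1 1.
Definition sd_mul (x y : G) : G :=
  mk (sd_fst x * alpha (sd_snd x) (sd_fst y)) (sd_snd x * sd_snd y).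
Definition sd_inv (x : G) : G :=
  mk (alpha (sd_snd x)^-1 (sd_fst x)^-1) (sd_snd x)^-1.

Lemma act1 a : alpha 1 a = a.
Proof.
by apply: (bij_inj (act_bij alpha 1)); rewrite -actM mulg1.
Qed.

Lemma act_mul b a a' : alpha b (a * a') = alpha b a * alpha b a'.
Proof. exact: gmulfM. Qed.

Lemma act_one b : alpha b 1 = 1.
Proof. by apply: (mulgI (alpha b 1)); rewrite -act_mul !mulg1. Qed.

Lemma sd_mulA : associative sd_mul.
Proof.
move=> [a b] [a' b'] [a'' b'']; rewrite /sd_mul /=.
by rewrite act_mul actM !mulgA.
Qed.

Lemma sd_mul1 : left_id sd_one sd_mul.
Proof. by move=> [a b]; rewrite /sd_mul /= act1 !mul1g. Qed.

Lemma sd_mulr1 : right_id sd_one sd_mul.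
Proof. by move=> [a b]; rewrite /sd_mul /= act_one !mulg1. Qed.

Lemma sd_mulV : left_inverse sd_one sd_inv sd_mul.
Proof.
by move=> [a b]; rewrite /sd_mul /sd_inv /sd_one /= -act_mul !mulVg act_one.
Qed.

Lemma sd_mulrV : right_inverse sd_one sd_inv sd_mul.
Proof.
move=> [a b]; rewrite /sd_mul /sd_inv /sd_one /=.
by rewrite -actM !mulgV act1 mulgV.
Qed.

HB.instance Definition _ := isGroup.Build G
  sd_mulA sd_mul1 sd_mulr1 sd_mulV sd_mulrV.

End SemidirectProduct.

(* Main.v *)
Require Import Defs.
From mathcomp Require Import all_boot all_order all_algebra finmap.
From mathcomp Require Import all_classical all_reals.
From mathcomp Require Import topology normedtype zify lra.

Set Implicit Arguments.
Unset Strict Implicit.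
Unset Printing Implicit Defensive.

Import Order.TTheory GRing.Theory Num.Theory.
Import numFieldNormedType.Exports.

(** The F_l = N_l x H_l form the required sequence in G.

    They are Foelner because left translation by (a, b) maps a rectangle A x B
    to the rectangle (a alpha_b(A)) x (b B): the proportion of F_l that stays
    in F_l is the product of two proportions, which tend to 1 by condition (2)
    and by the Foelner property of H (Folner_cvgP, flcoset_rect).

    They satisfy F_(n+k) <= F_n F_k: if b = b1 b2 with b1 in H_n and b2 in H_k,
    then condition (3) gives z in N_n x and in alpha_b1(N_k), and
    (x, b) = (x z^-1, b1) (alpha_b1^-1(z), b2), where x z^-1 lies in N_n since
    N_n is symmetric.

    Their approximation constants are bounded by L_H L_N^(2 M^2 - 1). Two facts
    carry this. First, N_l^(k+1) is covered by L_N^k translates of N_l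
    (covered_fpow). Second, condition (1) and N_(l M) <= N_l^M show that alpha_b
    maps N_l^k into N_l^(M k) for b in H_l (act_fpow). Given
    (a, b) and (a', b') in F_l, cover b^-1 b' = h k by a translate of H_l, with
    k in H_l and h among at most L_H elements. Then
      (a, b)^-1 (a', b') = (1, h) (alpha_(h^-1 b^-1) (a^-1 a'), k).
    Although h may lie outside H_l, the element h^-1 b^-1 = k b'^-1 is a
    product of two elements of H_l, so the first coordinate lies in
    N_l^(2 M^2), which is covered by a bounded number of translates of N_l
    (covered_rect). *)

Local Open Scope group_scope.

(** * Product sets and coverings by translates *)

Section ProductSets.
Variable G : groupType.
Local Open Scope fset_scope.
Implicit Types (A B : {fset G}) (g x y : G) (s t : seq G).

Lemma mem_flcoset g A x : (x \in flcoset g A) = (g^-1 * x \in A).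
Proof.
apply/imfsetP/idP => [[y yA ->]|gxA]; first by rewrite mulKg.
by exists (g^-1 * x); rewrite ?mulVKg.
Qed.

Lemma mem_frcoset A g x : (x \in frcoset A g) = (x * g^-1 \in A).
Proof.
apply/imfsetP/idP => [[y yA ->]|gxA]; first by rewrite mulgK.
by exists (x * g^-1); rewrite ?mulgVK.
Qed.

Lemma mem_finvg A x : (x \in finvg A) = (x^-1 \in A).
Proof.
apply/imfsetP/idP => [[y yA ->]|xA]; first by rewrite invgK.
by exists x^-1; rewrite ?invgK.
Qed.

Lemma fmulgP A B x :
  reflect (exists2 y, y \in A & exists2 z, z \in B & x = y * z)
    (x \in fmulg A B).
Proof. exact: imfset2P. Qed.

Lemma mem_fmulg A B x y : x \in A -> y \in B -> x * y \in fmulg A B.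
Proof. by move=> xA yB; apply/fmulgP; exists x => //; exists y. Qed.

Lemma fmulgSS A A' B B' :
  A `<=` A' -> B `<=` B' -> fmulg A B `<=` fmulg A' B'.
Proof.
move=> /fsubsetP sA /fsubsetP sB; apply/fsubsetP => _ /fmulgP[y yA [z zB ->]].
by apply: mem_fmulg; [exact: sA | exact: sB].
Qed.

Lemma card_flcoset g A : #|` flcoset g A| = #|` A|.
Proof. by rewrite card_imfset //; exact: mulgI. Qed.

Definition fpow A k : {fset G} := iter k (fun B => fmulg B A) [fset 1].

Lemma fpow1 A : fpow A 1 = A.
Proof.
apply/fsetP => x; apply/fmulgP/idP => [[y /fset1P-> [z zA ->]]|xA].
  by rewrite mul1g.
by exists 1; rewrite ?in_fset1 //; exists x; rewrite ?mul1g.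
Qed.

Lemma fpowD A j k x y :
  x \in fpow A j -> y \in fpow A k -> x * y \in fpow A (j + k).
Proof.
move=> xj; elim: k y => [|k IHk] y.
  by move=> /fset1P->; rewrite addn0 mulg1.
case/fmulgP=> z zk [a aA ->]; rewrite addnS mulgA.
exact/mem_fmulg/aA/IHk.
Qed.

(** The translates are listed by a sequence, not by a family over an ordinal:
    the coverings below are indexed by products, and only the number of
    translates matters. *)
Definition covered_by s A B :=
  forall x, x \in B -> exists2 t, t \in s & t^-1 * x \in A.

Lemma approx_groupP L A :
  approx_group_wrt L A <->
  1 \in A /\ exists2 s, size s = L & covered_by s A (fmulg (finvg A) A).
Proof.
split=> [[L0 A1 [g cov]]|[A1 [s <- cov]]].
  split=> //; exists [seq g i | i <- enum 'I_L].
    by rewrite size_map size_enum_ord.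
  move=> x /cov[i]; rewrite mem_flcoset => xi; exists (g i) => //.
  by apply: map_f; rewrite mem_enum.
have x1 : 1 \in fmulg (finvg A) A.
  by rewrite -[1]mul1g mem_fmulg // mem_finvg invg1.
split=> //; first by have [t] := cov _ x1; case: (s).
exists (tnth (in_tuple s)) => x /cov[t ts xt].
exists (Ordinal (etrans (index_mem t s) ts)).
by rewrite mem_flcoset (tnth_nth 1) /= nth_index.
Qed.

(** The default value in [approx_const] is never reached for an approximate
    group, since a nonempty set of natural numbers has a minimum. *)
Lemma approx_const_spec A : approx_group A ->
  approx_group_wrt (approx_const A) A /\
  forall L, approx_group_wrt L A -> (approx_const A <= L)%N.
Proof.
case=> L0 AL0; rewrite /approx_const; case: xgetP => [L -> []|none] //.
have ex : exists L, `[< approx_group_wrt L A >] by exists L0; apply/asboolP.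
case: (ex_minnP ex) => L /asboolP AL minL.
by case: (none L); split=> // L' AL'; apply: minL; apply/asboolP.
Qed.

(** From A A <= X A one gets A^(k+1) <= X^k A, absorbing one factor A at a
    time: A^(k+2) = A^(k+1) A <= X^k A A <= X^k X A. *)
Lemma covered_fpow s A k : covered_by s A (fmulg A A) ->
  exists2 t, size t = (size s ^ k)%N & covered_by t A (fpow A k.+1).
Proof.
move=> cov; elim: k => [|k [t sz covt]].
  exists [:: 1] => // x; rewrite fpow1 => xA.
  by exists 1; rewrite ?inE // invg1 mul1g.
exists [seq u * v | u <- t, v <- s]; first by rewrite size_allpairs sz expnSr.
move=> _ /fmulgP[y /covt[u ut uy] [z zA ->]].
have [v vs] := cov _ (mem_fmulg uy zA).
exists (u * v); first exact: allpairs_f.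
by rewrite invgM -mulgA (mulgA u^-1).
Qed.

End ProductSets.

(** * Foelner sequences *)

(** The defect of a product is at most the sum of the relative defects:
    m n - p q = (m - p) q + m (n - q). *)
Lemma ltr_mul_defects (R : realFieldType) (m n p q eps : R) :
  (0 < n -> p <= m -> q <= n ->
  (1 - eps / 2) * m < p -> (1 - eps / 2) * n < q ->
  (1 - eps) * (m * n) < p * q)%R.
Proof.
move=> n0 pm qn mp nq.
have h1 : ((m - p) * q <= (m - p) * n)%R by apply: ler_wpM2l; lra.
have h2 : ((m - p) * n < eps / 2 * m * n)%R by rewrite ltr_pM2r //; lra.
have m0 : (0 <= m)%R by nra.
have h3 : (m * (n - q) <= m * (eps / 2 * n))%R by apply: ler_wpM2l => //; lra.
lra.
Qed.

Section FolnerSequences.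
Variables (R : realType) (G : groupType).
Local Open Scope fset_scope.
Implicit Types (F : nat -> {fset G}) (A : {fset G}) (g : G).

(** The two halves of the symmetric difference have the same size because
    translation preserves cardinality. *)
Lemma card_fsymdiff_flcoset g A :
  (#|` fsymdiff (flcoset g A) A| + 2 * #|` flcoset g A `&` A| = 2 * #|` A|)%N.
Proof.
have disj : (flcoset g A `\` A) `&` (A `\` flcoset g A) = fset0.
  by apply/fsetP => x; rewrite !inE; case: (x \in A); rewrite ?andbF.
have := cardfsUI (flcoset g A `\` A) (A `\` flcoset g A).
rewrite disj cardfs0 addn0 -/(fsymdiff _ _) => ->.
have := cardfsID A (flcoset g A); have := cardfsID (flcoset g A) A.
rewrite card_flcoset fsetIC => h1 h2; lia.
Qed.

Local Open Scope ring_scope.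

Lemma Folner_defect_eq g A : (0 < #|` A|)%N ->
  (#|` fsymdiff (flcoset g A) A|)%:R / (#|` A|)%:R =
  2 * (1 - (#|` flcoset g A `&` A|)%:R / (#|` A|)%:R) :> R.
Proof.
move=> A0; have nz : (#|` A|)%:R != 0 :> R by rewrite pnatr_eq0 -lt0n.
have /(congr1 (fun n => n%:R : R)) := card_fsymdiff_flcoset g A.
rewrite natrD !natrM => h; apply/eqP; rewrite -(inj_eq (mulIf nz)).
by rewrite divfK // -mulrA mulrBl divfK // mul1r mulrBr -h addrK.
Qed.

(** Asymptotic invariance in the form of condition (2). This form passes to
    products of sets: an intersection of rectangles is again a rectangle, while
    a symmetric difference of rectangles is not. *)
Lemma Folner_cvgP F g : (forall n, (1 <= n)%N -> (0 < #|` F n|)%N) ->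
  (((#|` fsymdiff (flcoset g (F n)) (F n)|)%:R / (#|` F n|)%:R : R)%R
     @[n --> \oo] --> (0 : R)%R)%classic <->
  forall eps : R, 0 < eps -> exists2 K, (1 <= K)%N & forall l, (K <= l)%N ->
    (1 - eps) * (#|` F l|)%:R < (#|` flcoset g (F l) `&` F l|)%:R.
Proof.
move=> F0.
have defect l eps : (1 <= l)%N ->
    (`|0 - (#|` fsymdiff (flcoset g (F l)) (F l)|)%:R / (#|` F l|)%:R : R|
       < 2 * eps) =
    ((1 - eps) * (#|` F l|)%:R < (#|` flcoset g (F l) `&` F l|)%:R).
  move=> /F0 Fl; rewrite sub0r normrN ger0_norm ?divr_ge0 //.
  rewrite Folner_defect_eq // ltr_pM2l // -ltr_pdivlMr ?ltr0n //.
  by rewrite ltrBlDl -ltrBlDr.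
split=> [/cvgrPdist_lt cvg eps eps0|cap].
  have [K _ hK] := cvg _ (mulr_gt0 (ltr0Sn R 1) eps0).
  exists K.+1 => // l Kl; rewrite -defect ?(leq_trans _ Kl) //.
  by apply: hK; rewrite /= (leq_trans _ Kl).
apply/cvgrPdist_lt => eps eps0.
have [K K1 hK] := cap _ (divr_gt0 eps0 (ltr0Sn R 1)).
exists K => // l /= Kl; have := hK l Kl.
by rewrite -defect ?(leq_trans K1 Kl) // (mulrC 2) divfK // pnatr_eq0.
Qed.

End FolnerSequences.

(** * Rectangles in the semidirect product *)

Section Rectangles.
Variables (H N : groupType) (alpha : aut_action H N).
Local Open Scope fset_scope.
Implicit Types (A : {fset N}) (B : {fset H}).

Definition rect A B : {fset semidirect alpha} :=
  [fset Semidirect alpha a b | a in A, b in B].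

Lemma mem_rect A B x : (x \in rect A B) = (sd_fst x \in A) && (sd_snd x \in B).
Proof.
apply/imfset2P/andP => [[a aA [b bB ->]]|[xA xB]]; first by split.
by exists (sd_fst x) => //; exists (sd_snd x) => //; case: (x).
Qed.

Lemma card_rect A B : #|` rect A B| = (#|` A| * #|` B|)%N.
Proof.
rewrite (perm_size (enum_imfset2 _ _)) ?size_allpairs //.
by move=> [a b] [a' b'] _ _ /= [-> ->].
Qed.

Lemma rectI A A' B B' : rect A B `&` rect A' B' = rect (A `&` A') (B `&` B').
Proof. by apply/fsetP => x; rewrite in_fsetI !mem_rect !in_fsetI andbACA. Qed.

Lemma rectS A A' B B' : A `<=` A' -> B `<=` B' -> rect A B `<=` rect A' B'.
Proof.
move=> /fsubsetP sA /fsubsetP sB; apply/fsubsetP => x; rewrite !mem_rect.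
by case/andP=> /sA-> /sB->.
Qed.

Lemma actK b : cancel (alpha b) (alpha b^-1).
Proof. by move=> a; rewrite -actM mulVg act1. Qed.

Lemma actVK b : cancel (alpha b^-1) (alpha b).
Proof. by move=> a; rewrite -actM mulgV act1. Qed.

Lemma mem_act_imfset b A x : (x \in alpha b @` A) = (alpha b^-1 x \in A).
Proof.
apply/imfsetP/idP => [[y yA ->]|xA]; first by rewrite actK.
by exists (alpha b^-1 x); rewrite ?actVK.
Qed.

Lemma flcoset_rect a b A B :
  flcoset (Semidirect alpha a b) (rect A B) =
  rect (flcoset a (alpha b @` A)) (flcoset b B).
Proof.
apply/fsetP => x; rewrite mem_flcoset !mem_rect !mem_flcoset mem_act_imfset.
by rewrite act_mul.
Qed.

End Rectangles.

(** * Growth along the sequence and under the action *)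

Section Growth.
Local Open Scope fset_scope.

Lemma increasing_leq (G : groupType) (F : nat -> {fset G}) :
  (forall n, (1 <= n)%N -> F n `<=` F n.+1) ->
  forall m n, (1 <= m)%N -> (m <= n)%N -> F m `<=` F n.
Proof.
move=> incF m n m1 /subnKC <-; elim: (n - m)%N => [|d IHd].
  by rewrite addn0.
by rewrite addnS (fsubset_trans IHd) // incF // (leq_trans m1) ?leq_addr.
Qed.

Lemma sub_fpow (G : groupType) (F : nat -> {fset G}) :
  (forall n k, (1 <= n)%N -> (1 <= k)%N -> F (n + k)%N `<=` fmulg (F n) (F k)) ->
  forall l k, (1 <= l)%N -> (1 <= k)%N -> F (l * k)%N `<=` fpow (F l) k.
Proof.
move=> subF l [//|k] l1 _; elim: k => [|k IHk]; first by rewrite muln1 fpow1.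
rewrite mulnS addnC (fsubset_trans (subF _ _ _ _)) ?muln_gt0 ?l1 //.
exact: fmulgSS.
Qed.

Variables (H N : groupType) (alpha : aut_action H N).
Variables (A : {fset N}) (B : {fset H}) (M : nat).
Implicit Types (a : N) (b : H).

(** A homomorphism maps a product of k elements of A to the product of their
    images, each of which is a product of M elements of A. *)
Lemma act_fpow b k x :
  (forall b a, b \in B -> a \in A -> alpha b a \in fpow A M) ->
  b \in B -> x \in fpow A k ->
  alpha b x \in fpow A (M * k).
Proof.
move=> actB bB; elim: k x => [|k IHk] x.
  by rewrite muln0 => /fset1P->; rewrite act_one in_fset1.
case/fmulgP=> y yk [a aA ->]; rewrite act_mul mulnS addnC.
by apply: fpowD; [exact: IHk | exact: actB].
Qed.

(** The exponent 2 M^2 comes from applying two elements of B in succession to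
    a product of two elements of A. *)
Lemma covered_rect (s : seq N) (t : seq H) :
  (forall b a, b \in B -> a \in A -> alpha b a \in fpow A M) ->
  A = finvg A -> B = finvg B ->
  covered_by s A (fpow A (M * (M * 2))) ->
  covered_by t B (fmulg (finvg B) B) ->
  covered_by [seq Semidirect alpha 1 h * Semidirect alpha x 1 | h <- t, x <- s]
    (rect alpha A B) (fmulg (finvg (rect alpha A B)) (rect alpha A B)).
Proof.
move=> actB symA symB covA covB _ /fmulgP[p + [q + ->]].
rewrite mem_finvg -[p in p * q]invgK.
case: (p^-1) q => [a b] [a' b']; rewrite !mem_rect /=.
move=> /andP[aA bB] /andP[a'A b'B].
have b'V : b'^-1 \in B by rewrite symB mem_finvg invgK.
have aV : a^-1 \in A by rewrite symA mem_finvg invgK.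
have [h ht hB] : exists2 h, h \in t & h^-1 * (b^-1 * b') \in B.
  by apply/covB/mem_fmulg; rewrite ?mem_finvg ?invgK.
pose k := h^-1 * (b^-1 * b').
pose u := alpha k (alpha b'^-1 (a^-1 * a')).
(* u is alpha_(h^-1 b^-1) (a^-1 a'), because k b'^-1 = h^-1 b^-1. *)
have uA : u \in fpow A (M * (M * 2)).
  apply/act_fpow/act_fpow => //.
  by rewrite -[2%N]/(1 + 1)%N fpowD // fpow1.
have [x xs xA] := covA _ uA.
exists (Semidirect alpha 1 h * Semidirect alpha x 1); first exact: allpairs_f.
have -> : (Semidirect alpha a b)^-1 * Semidirect alpha a' b' =
   Semidirect alpha 1 h * Semidirect alpha x 1 * Semidirect alpha (x^-1 * u) k.
  rewrite -[LHS]/(Semidirect alpha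
    (alpha b^-1 a^-1 * alpha b^-1 a') (b^-1 * b')).
  rewrite -[RHS]/(Semidirect alpha
    (1 * alpha h x * alpha (h * 1) (x^-1 * u)) (h * 1 * k)).
  rewrite mul1g mulg1 -!act_mul mulVKg /u -!actM.
  by rewrite /k mulVKg mulgK.
by rewrite (mulKg (Semidirect alpha 1 h * Semidirect alpha x 1)) mem_rect xA.
Qed.

End Growth.

Theorem theorem3p2p1 (R : realType) (N H : groupType)
  (countN : countable [set: N]) (countH : countable [set: H])
  (alpha : aut_action H N)
  (NF : nat -> {fset N}) (HF : nat -> {fset H})
  (safcN : SAFC R NF) (symN : symmetric_seq NF)
  (safcH : SAFC R HF) (symH : symmetric_seq HF)
  (M : nat) (M_gt0 : (1 <= M)%N)
  (xi : nat -> nat -> nat)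
  (xi_gt0 : forall i j, (1 <= i)%N -> (1 <= j)%N -> (1 <= xi i j)%N)
  (cond1 : forall i j, (1 <= i)%N -> (1 <= j)%N ->
     (act_img alpha (HF i) (NF j) `<=` NF (xi i j))%fset /\
     (xi i i <= i * M)%N)
  (cond2 : forall (a : N) (b : H) (eps : R), (0 < eps)%R ->
     exists2 K, (1 <= K)%N & forall l, (K <= l)%N ->
       ((1 - eps) * (#|` NF l|)%:R <
        (#|` flcoset a (alpha b @` NF l) `&` NF l|%fset)%:R)%R)
  (cond3 : forall l1 l2, (1 <= l1)%N -> (1 <= l2)%N ->
     forall x b, x \in NF (l1 + l2)%N -> b \in HF l1 ->
     (frcoset (NF l1) x `&` (alpha b @` NF l2) != fset0)%fset) :
  satisfies_AFC R (semidirect alpha).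
Proof.
case: safcN => [[[LN [[incN N1 exN _] apN LNle]] mulN] _].
case: safcH => [[[LH [[incH H1 exH cvgH] apH LHle]] mulH] _].
have cardN l : (1 <= l)%N -> (0 < #|` NF l|)%N.
  by move=> /N1 l1; rewrite cardfs_gt0; apply/fset0Pn; exists 1.
have cardH l : (1 <= l)%N -> (0 < #|` HF l|)%N.
  by move=> /H1 l1; rewrite cardfs_gt0; apply/fset0Pn; exists 1.
have actN l : (1 <= l)%N ->
    forall b a, b \in HF l -> a \in NF l -> alpha b a \in fpow (NF l) M.
  move=> l1 b a bH aN; have [/fsubsetP sub xil] := cond1 l l l1 l1.
  (* alpha_b(N_l) <= N_(xi l l) <= N_(l M) <= N_l^M *)
  apply: (fsubsetP (sub_fpow mulN l1 M_gt0)).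
  apply: (fsubsetP (increasing_leq incN (xi_gt0 l l l1 l1) xil)).
  by apply: sub; apply/imfset2P; exists b => //; exists a.
pose F l := rect alpha (NF l) (HF l).
have apF l : (1 <= l)%N ->
    exists2 L, (L <= LH * LN ^ (M * (M * 2)).-1)%N & approx_group_wrt L (F l).
  move=> l1.
  have [/approx_groupP[_ [s szs covs]] _] := approx_const_spec (apN l l1).
  have [/approx_groupP[_ [t szt covt]] _] := approx_const_spec (apH l l1).
  rewrite -symN // in covs.
  have [s' szs' covs'] := covered_fpow (M * (M * 2)).-1 covs.
  rewrite prednK ?muln_gt0 ?M_gt0 // in covs'.
  have covr := covered_rect (actN l l1) (symN l l1) (symH l l1) covs' covt.
  exists (size t * size s')%N.
    rewrite szs' szs szt leq_mul ?LHle //.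
    by case: (_.-1) => // e; rewrite leq_exp2r ?LNle.
  apply/approx_groupP; split; last first.
    eexists; last exact: covr.
    exact: size_allpairs.
  by rewrite /F mem_rect /= N1 ?H1.
exists F; split; last first.
  move=> n k n1 k1; apply/fsubsetP => -[x b].
  rewrite mem_rect /= => /andP[xN bH].
  have /fmulgP[b1 b1H [b2 b2H ->]] := fsubsetP (mulH n k n1 k1) _ bH.
  have /fset0Pn[z] := cond3 n k n1 k1 x b1 xN b1H.
  rewrite in_fsetI mem_frcoset mem_act_imfset => /andP[zxN zN].
  apply/fmulgP; exists (Semidirect alpha (x * z^-1) b1).
    by rewrite mem_rect /= b1H andbT symN // mem_finvg invgM invgK.
  exists (Semidirect alpha (alpha b1^-1 z) b2); first by rewrite mem_rect /= zN.
  by congr Semidirect; rewrite /= actVK mulgVK.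
exists (LH * LN ^ (M * (M * 2)).-1)%N; split.
- split.
  + by move=> n n1; apply: rectS; [exact: incN | exact: incH].
  + by move=> n n1; rewrite mem_rect N1 ?H1.
  + move=> [a b]; have [n n1 aN] := exN a; have [m m1 bH] := exH b.
    exists (maxn n m); first by rewrite leq_max n1.
    rewrite mem_rect /= (fsubsetP (increasing_leq incN n1 (leq_maxl n m))) //=.
    by rewrite (fsubsetP (increasing_leq incH m1 (leq_maxr n m))).
  + move=> [a b]; apply/Folner_cvgP => [l l1|eps eps0].
      by rewrite card_rect muln_gt0 cardN ?cardH.
    have eps20 : (0 < eps / 2)%R by rewrite divr_gt0.
    have [K1 K11 hK1] := cond2 a b _ eps20.
    have [K2 K21 hK2] := (Folner_cvgP R b cardH).1 (cvgH b) _ eps20.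
    exists (maxn K1 K2) => [|l]; first by rewrite leq_max K11.
    move=> Kl; have := Kl; rewrite geq_max => /andP[/hK1 capN /hK2 capH].
    rewrite flcoset_rect rectI !card_rect !natrM.
    have l1 := leq_trans K11 (leq_trans (leq_maxl K1 K2) Kl).
    have leN : (#|` flcoset a (alpha b @` NF l) `&` NF l|%fset <= #|` NF l|)%N.
      exact/fsubset_leq_card/fsubsetIr.
    have leH : (#|` flcoset b (HF l) `&` HF l|%fset <= #|` HF l|)%N.
      exact/fsubset_leq_card/fsubsetIr.
    rewrite -(ler_nat R) in leN; rewrite -(ler_nat R) in leH.
    by apply: ltr_mul_defects => //; rewrite ltr0n cardH.
- move=> n n1; have [L _ FL] := apF n n1; by exists L.
- move=> n n1; have [L LL FL] := apF n n1; apply: leq_trans LL.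
  by apply: (approx_const_spec _).2 => //; exists L.
Qed.
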